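(* For any map $\iota_X\colon A\to X$ and any integer $k\ge 0$, $$\operatorname{secat}\iota_X\;\le\;\operatorname{relcat}_k\iota_X\;\le\;\operatorname{secat}\iota_X+k+1 .$$
   Context: Spaces are topological spaces; $\simeq$ denotes homotopy of maps, and all squares below commute up to homotopy. Ganea construction. For a map $\iota_X\colon A\to X$, define maps $g_i=g_i(\iota_X)\colon G_i=G_i(\iota_X)\to X$ for $i\ge 0$ inductively. Start with $G_0=A$ and $g_0=\iota_X$. Given $g_i$, let $F_i$ be the homotopy pullback of $g_i\colon G_i\to X$ and $\iota_X\colon A\to X$, with projections $\beta_i\colon F_i\to G_i$ and $\eta_i\colon F_i\to A$. Let $G_{i+1}$ be the homotopy pushout of $\beta_i$ and $\eta_i$, with structure maps $\gamma_i\colon G_i\to G_{i+1}$ and $\alpha_{i+1}\colon A\to G_{i+1}$. Let $g_{i+1}\colon G_{i+1}\to X$ be the map induced by $g_i$, $\iota_X$ and the homotopy of the pullback square, so that $g_{i+1}\circ\gamma_i\simeq g_i$ and $g_{i+1}\circ\alpha_{i+1}\simeq\iota_X$. That is, $g_{i+1}$ is the join of $g_i$ and $\iota_X$ over $X$. For $0\le k< i$ let $\gamma_{k,i}\simeq \gamma_{i-1}\circ\cdots\circ\gamma_{k+1}\circ\gamma_k\colon G_k\to G_i$, and $\gamma_{k,k}=\mathrm{id}_{G_k}$. (Equivalently, by associativity of the join, $G_i$ is the homotopy pushout of the two projections from the homotopy pullback of $g_k$ and $g_{i-k-1}$, and $\gamma_{k,i}$ is the structure map from $G_k$.) A homotopy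 section of $g_n\colon G_n\to X$ is a map $\sigma\colon X\to G_n$ with $g_n\circ\sigma\simeq\mathrm{id}_X$. $\operatorname{secat}\iota_X$ (sectional category) is the least integer $n\ge 0$ such that $g_n$ has a homotopy section. $\operatorname{relcat}_k\iota_X$ (relative category of order $k$) is the least integer $n\ge k$ such that $g_n$ has a homotopy section $\sigma$ with $\sigma\circ g_k\simeq\gamma_{k,n}$. If no such integer exists, the corresponding invariant is $\infty$. *)

(* Defs.v *)
From HB Require Import structures.
From mathcomp Require Import all_boot all_order all_algebra generic_quotient.
From mathcomp Require Import all_classical all_reals all_analysis.

Set Implicit Arguments.
Unset Strict Implicit.
Unset Printing Implicit Defensive.

Import Order.TTheory GRing.Theory Num.Theory.
Import numFieldNormedType.Exports.

Local Open Scope classical_set_scope.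
Local Open Scope ring_scope.
Local Open Scope quotient_scope.

Section unit_interval.
Variable R : realType.

Let A : set R := [set` `[0, 1]].

Definition unit_itv : topologicalType := set_type [set` `[0, 1 : R]].

Let itv0_subproof : (0 : R) \in A.
Proof. by rewrite inE /A /= in_itv /= lexx ler01. Qed.

Let itv1_subproof : (1 : R) \in A.
Proof. by rewrite inE /A /= in_itv /= lexx ler01. Qed.

Definition itv0 : unit_itv := exist _ 0 itv0_subproof.
Definition itv1 : unit_itv := exist _ 1 itv1_subproof.

Lemma itv1_neq0 : itv1 != itv0.
Proof. by apply/eqP => /(congr1 val)/eqP; rewrite /= oner_eq0. Qed.

Lemma unit_itv_hausdorff : hausdorff_space unit_itv.
Proof.
move=> x y xy; apply: val_inj; apply: (@Rhausdorff R) => U V Ux Vy.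
have cv := @initial_continuous A R set_val.
have [z [Uz Vz]] := xy _ _ (cv x U Ux) (cv y V Vy).
by exists (val z).
Qed.

Lemma unit_itv_compact : compact [set: unit_itv].
Proof.
move=> F FF _; pose G := (set_val : unit_itv -> R) @ F.
have PG : ProperFilter G by exact: fmap_proper_filter.
have GA : G A by apply: (@filterE _ F) => z; exact: (set_mem (valP z)).
have [x [Ax xG]] := @segment_compact R 0 1 G PG GA.
exists (exist _ x (mem_set Ax)); split=> // B U FB.
rewrite nbhsE => -[_ [[V oV <-] Vx] VU].
have GB : G (set_val @` B) by apply: (@filterS _ F _ B) => // z Bz; exists z.
have [_ [[b Bb <-] Vb]] := xG _ V GB (open_nbhs_nbhs (conj oV Vx)).
by exists b; split=> //; apply: VU.
Qed.

Lemma unit_itv_locally_compact : locally_compact [set: unit_itv].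
Proof.
move=> x _; exists setT; first by rewrite withinET; exact: filterT.
by split; [exact: unit_itv_compact|exact: closedT].
Qed.

Lemma unit_itv_regular : regular_space unit_itv.
Proof.
by move=> x; apply: (compact_regular unit_itv_hausdorff unit_itv_compact);
  exact: filterT.
Qed.

End unit_interval.

Section continuity.
Context {X Y Z : topologicalType}.

Lemma ctsC (f : X -> Y) (g : Y -> Z) :
  continuous f -> continuous g -> continuous (g \o f).
Proof. by move=> cf cg x; apply: continuous_comp; [exact: cf|exact: cg]. Qed.

Lemma cts_pair (f : X -> Y) (g : X -> Z) :
  continuous f -> continuous g -> continuous (fun x => (f x, g x)).
Proof. by move=> cf cg x; exact: cvg_pair (cf x) (cg x). Qed.

End continuity.

Section homotopy_constructions.
Variable R : realType.
Local Notation I := (unit_itv R).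

Definition homotopic (X Y : topologicalType) (f g : X -> Y) : Prop :=
  exists2 H : X * I -> Y, continuous H &
    forall x, H (x, itv0 R) = f x /\ H (x, itv1 R) = g x.

(* Continuous maps [I -> X] with the compact-open topology. *)
Definition path_space (X : topologicalType) : Type := continuousType I X.

HB.instance Definition _ (X : topologicalType) :=
  Topological.copy (path_space X)
    (initial_topology (id : continuousType I X -> {compact-open, I -> X})).

Definition path_eval (X : topologicalType) (w : path_space X) : I -> X :=
  (w : continuousType I X).

Lemma path_eval_continuous (X : topologicalType) :
  continuous (uncurry (@path_eval X)).
Proof.
apply: continuous_uncurry_regular.
- exact: unit_itv_locally_compact.
- exact: unit_itv_regular.
- exact: initial_continuous.
- by move=> w; exact: cts_fun.
Qed.

(** The homotopy pullback of [f : B -> X] and [g : C -> X]: triples of a point of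
    [B], a path in [X] and a point of [C], where the path runs from the image
    under [f] to the image under [g]. *)
Section hpullback.
Variables (B C X : topologicalType) (f : B -> X) (g : C -> X).

Definition hpullback : topologicalType :=
  set_type [set p : B * path_space X * C |
    path_eval p.1.2 (itv0 R) = f p.1.1 /\
    path_eval p.1.2 (itv1 R) = g p.2].

Definition hpb_fst (p : hpullback) : B := (val p).1.1.
Definition hpb_path (p : hpullback) : path_space X := (val p).1.2.
Definition hpb_snd (p : hpullback) : C := (val p).2.

Lemma hpb_path0 p : path_eval (hpb_path p) (itv0 R) = f (hpb_fst p).
Proof. by case: (set_mem (valP p)). Qed.

Lemma hpb_path1 p : path_eval (hpb_path p) (itv1 R) = g (hpb_snd p).
Proof. by case: (set_mem (valP p)). Qed.

Let val_continuous : continuous (set_val : hpullback -> B * path_space X * C).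
Proof. exact: initial_continuous. Qed.

Lemma hpb_fst_continuous : continuous hpb_fst.
Proof.
have -> : hpb_fst = fst \o (fst \o set_val) by [].
apply: ctsC; last by move=> ?; exact: cvg_fst.
by apply: ctsC; [exact: val_continuous|move=> ?; exact: cvg_fst].
Qed.

Lemma hpb_path_continuous : continuous hpb_path.
Proof.
have -> : hpb_path = snd \o (fst \o set_val) by [].
apply: ctsC; last by move=> ?; exact: cvg_snd.
by apply: ctsC; [exact: val_continuous|move=> ?; exact: cvg_fst].
Qed.

Lemma hpb_snd_continuous : continuous hpb_snd.
Proof.
have -> : hpb_snd = snd \o set_val by [].
by apply: ctsC; [exact: val_continuous|move=> ?; exact: cvg_snd].
Qed.

HB.instance Definition _ := @isContinuous.Build _ _ hpb_fst hpb_fst_continuous.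
HB.instance Definition _ := @isContinuous.Build _ _ hpb_snd hpb_snd_continuous.

Definition hpb_homotopy (z : hpullback * I) : X := path_eval (hpb_path z.1) z.2.

Lemma hpb_homotopy_continuous : continuous hpb_homotopy.
Proof.
have -> : hpb_homotopy = uncurry (@path_eval X) \o (fun z => (hpb_path z.1, z.2)).
  by apply/funext => -[p t].
apply: ctsC; last exact: path_eval_continuous.
apply: cts_pair; last by move=> ?; exact: cvg_snd.
by apply: (ctsC (f := fst)); [move=> ?; exact: cvg_fst|exact: hpb_path_continuous].
Qed.

End hpullback.

(** The homotopy pushout of [u : P -> B] and [v : P -> C] is the double mapping
    cylinder: the disjoint sum of [B], [C] and [P * I] in which [(p, 0)] is
    glued to [u p] and [(p, 1)] to [v p]. *)
Section hpushout.
Variables (P B C : topologicalType) (u : P -> B) (v : P -> C).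

Definition cyl_piece (i : option bool) : topologicalType :=
  match i with
  | None => (P * I)%type
  | Some true => B
  | Some false => C
  end.

Definition cyl_sum : topologicalType := {i : option bool & cyl_piece i}.

Definition cyl_left (b : B) : cyl_sum := existT cyl_piece (Some true) b.
Definition cyl_right (c : C) : cyl_sum := existT cyl_piece (Some false) c.
Definition cyl_mid (z : P * I) : cyl_sum := existT cyl_piece None z.

(* Sends both ends of the cylinder to the points they are glued to and fixes
   everything else, so its fibers are exactly the classes of the equivalence
   relation generated by the gluing. *)
Definition cyl_collapse (s : cyl_sum) : cyl_sum :=
  match s with
  | existT None (p, t) =>
      if t == itv0 R then cyl_left (u p)
      else if t == itv1 R then cyl_right (v p) else cyl_mid (p, t)
  | s' => s'
  end.

Definition cyl_rel : equiv_rel cyl_sum :=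
  EquivRel (fun s s' => cyl_collapse s == cyl_collapse s')
    (fun s => eqxx (cyl_collapse s))
    (fun s s' => eq_sym (cyl_collapse s) (cyl_collapse s'))
    (fun s' s s'' e => etrans (congr1 (eq_op^~ _) (eqP e))).

Definition hpushout : topologicalType := quotient_topology {eq_quot cyl_rel}.

Let cyl_pi : cyl_sum -> hpushout := \pi_hpushout.

Let cyl_piP (s s' : cyl_sum) :
  reflect (cyl_collapse s = cyl_collapse s') (cyl_pi s == cyl_pi s').
Proof.
apply: (iffP eqP) => [e|e]; last by apply/eqmodP/eqP.
by apply/eqP; move/eqmodP: e.
Qed.

Definition hpo_left (b : B) : hpushout := cyl_pi (cyl_left b).
Definition hpo_right (c : C) : hpushout := cyl_pi (cyl_right c).
Definition hpo_mid (z : P * I) : hpushout := cyl_pi (cyl_mid z).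

Lemma hpo_mid0 p : hpo_mid (p, itv0 R) = hpo_left (u p).
Proof. by apply/eqP/cyl_piP; rewrite /= eqxx. Qed.

Lemma hpo_mid1 p : hpo_mid (p, itv1 R) = hpo_right (v p).
Proof. by apply/eqP/cyl_piP; rewrite /= (negbTE (itv1_neq0 R)) eqxx. Qed.

Lemma hpo_left_continuous : continuous hpo_left.
Proof.
apply: (@ctsC _ _ _ cyl_left cyl_pi); last exact: pi_continuous.
exact: (@existT_continuous _ cyl_piece (Some true)).
Qed.

Lemma hpo_right_continuous : continuous hpo_right.
Proof.
apply: (@ctsC _ _ _ cyl_right cyl_pi); last exact: pi_continuous.
exact: (@existT_continuous _ cyl_piece (Some false)).
Qed.

Lemma hpo_mid_continuous : continuous hpo_mid.
Proof.
apply: (@ctsC _ _ _ cyl_mid cyl_pi); last exact: pi_continuous.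
exact: (@existT_continuous _ cyl_piece None).
Qed.

HB.instance Definition _ :=
  @isContinuous.Build _ _ hpo_left hpo_left_continuous.
HB.instance Definition _ :=
  @isContinuous.Build _ _ hpo_right hpo_right_continuous.

Section hpushout_map.
Variables (Z : topologicalType) (f : B -> Z) (h : P * I -> Z) (g : C -> Z).

Definition cyl_map (s : cyl_sum) : Z :=
  match s with
  | existT None z => h z
  | existT (Some true) b => f b
  | existT (Some false) c => g c
  end.

Let cyl_map_continuous :
  continuous f -> continuous h -> continuous g -> continuous cyl_map.
Proof.
by move=> cf ch cg -[[[]|] x] U ?; rewrite /nbhs/= sigT_nbhsE;
  [apply: cf|apply: cg|apply: ch].
Qed.

Definition hpo_map (q : hpushout) : Z := cyl_map (repr q).

Hypothesis h0 : forall p, h (p, itv0 R) = f (u p).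
Hypothesis h1 : forall p, h (p, itv1 R) = g (v p).

Let cyl_map_collapse s : cyl_map (cyl_collapse s) = cyl_map s.
Proof.
case: s => -[[]|] //= [p t].
have [->|_] := eqVneq t (itv0 R); first by rewrite /cyl_map /= h0.
by have [->|//] := eqVneq t (itv1 R); rewrite /cyl_map /= h1.
Qed.

Lemma hpo_map_pi s : hpo_map (cyl_pi s) = cyl_map s.
Proof.
rewrite /hpo_map -[LHS]cyl_map_collapse -[RHS]cyl_map_collapse.
congr cyl_map.
by apply/cyl_piP; rewrite /cyl_pi reprK.
Qed.

Lemma hpo_map_left b : hpo_map (hpo_left b) = f b.
Proof. exact: hpo_map_pi. Qed.

Lemma hpo_map_right c : hpo_map (hpo_right c) = g c.
Proof. exact: hpo_map_pi. Qed.

Lemma hpo_map_mid z : hpo_map (hpo_mid z) = h z.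
Proof. exact: hpo_map_pi. Qed.

Lemma hpo_map_continuous :
  continuous f -> continuous h -> continuous g -> continuous hpo_map.
Proof.
move=> cf ch cg; apply/quotient_continuous.
rewrite (_ : _ \o _ = cyl_map); last by apply/funext => s; exact: hpo_map_pi.
exact: cyl_map_continuous.
Qed.

End hpushout_map.
End hpushout.

(** The join of [f] and [g] over [X]. *)
Section join.
Variables (B C X : topologicalType).
Variables (f : continuousType B X) (g : continuousType C X).

Definition join_space : topologicalType :=
  hpushout (@hpb_fst B C X f g) (@hpb_snd B C X f g).

Definition join_map : join_space -> X := hpo_map f (@hpb_homotopy B C X f g) g.

Lemma join_map_continuous : continuous join_map.
Proof.
apply: hpo_map_continuous; [exact: hpb_path0|exact: hpb_path1| | |].
- exact: cts_fun.
- exact: hpb_homotopy_continuous.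
- exact: cts_fun.
Qed.

HB.instance Definition _ := @isContinuous.Build _ _ join_map join_map_continuous.

End join.

Section ganea.
Variables (A X : topologicalType) (iota : continuousType A X).

Record space_over : Type := SpaceOver {
  over_space : topologicalType;
  over_map : continuousType over_space X
}.

Fixpoint ganea (i : nat) : space_over :=
  match i with
  | 0 => SpaceOver iota
  | j.+1 => SpaceOver (@join_map (over_space (ganea j)) A X
                         (over_map (ganea j)) iota)
  end.

Definition ganea_space (i : nat) : topologicalType := over_space (ganea i).

Definition ganea_map (i : nat) : continuousType (ganea_space i) X :=
  over_map (ganea i).

(* The structure map [gamma_i] of the homotopy pushout. *)
Definition ganea_incl (i : nat) :
    continuousType (ganea_space i) (ganea_space i.+1) :=
  @hpo_left _ _ _ (@hpb_fst _ _ _ (ganea_map i) iota)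
                  (@hpb_snd _ _ _ (ganea_map i) iota).

(* [gamma_(k, m + k)]; indexing by the difference [m] avoids a cast. *)
Fixpoint ganea_incl_iter (k m : nat) :
    continuousType (ganea_space k) (ganea_space (m + k)) :=
  match m with
  | 0 => idfun
  | l.+1 => ganea_incl (l + k) \o ganea_incl_iter k l
  end.

Definition has_hsection (n : nat) : Prop :=
  exists s : continuousType X (ganea_space n),
    homotopic (ganea_map n \o s) idfun.

(* [n] is written as [m + k], which encodes [k <= n]. *)
Definition has_rel_hsection (k n : nat) : Prop :=
  exists2 m : nat, n = (m + k)%N &
    exists s : continuousType X (ganea_space (m + k)),
      homotopic (ganea_map (m + k) \o s) idfun /\
      homotopic (s \o ganea_map k) (ganea_incl_iter k m).

End ganea.

(* The least [n] satisfying [Q], and [+oo] if there is none. *)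
Definition least_or_infty (Q : nat -> Prop) : \bar R :=
  match pselect (exists n, `[< Q n >]) with
  | left exQ => (ex_minn exQ)%:R%:E
  | right _ => +oo%E
  end.

Definition secat (A X : topologicalType) (iota : continuousType A X) : \bar R :=
  least_or_infty (has_hsection iota).

Definition relcat (A X : topologicalType) (iota : continuousType A X)
    (k : nat) : \bar R :=
  least_or_infty (has_rel_hsection iota k).

End homotopy_constructions.

(* Main.v *)
(** Idea. Everything happens over [X]: a map to [G_i] over [X] up to homotopy is
    a strict map over [X] to the path fibration [E_i -> X] replacing [g_i].
    If two maps [G_(k+1) -> E_N] over [X] are fibrewise homotopic on [G_k], they
    become fibrewise homotopic after inclusion in [E_(N+1)]. Indeed let [th] be
    such a map and consider a point [q] of the cylinder part of [G_(k+1)], on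
    the segment from [y] in [G_k] to [a] in [A]. One can move from [th q] along
    the join direction towards [a], and then let [q] slide back to [y] inside
    [th]; so the composite of [th] with the inclusion is homotopic to the join
    of the restriction of [th] to [G_k] with the identity of [A], which only
    depends on that restriction up to homotopy.
    Starting from a homotopy section of [g_n], one applies this to the inclusion
    of [G_i] and to the composite of [g_i] with the section for [i = 0, ..., k],
    each step costing one more join with [A]. *)
From HB Require Import structures.
Require Import Defs.
From mathcomp Require Import all_boot all_order all_algebra generic_quotient.
From mathcomp Require Import all_classical all_reals all_analysis.
From mathcomp Require Import lra.

Set Implicit Arguments.
Unset Strict Implicit.
Unset Printing Implicit Defensive.

Import Order.TTheory GRing.Theory Num.Theory.
Import numFieldNormedType.Exports.

Local Open Scope classical_set_scope.
Local Open Scope ring_scope.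

(** * Continuity and pasting along closed sets *)

Section continuity.
Context {T U V Z : topologicalType}.

Lemma continuous_fst : continuous (@fst T U).
Proof. by move=> ?; exact: cvg_fst. Qed.

Lemma continuous_snd : continuous (@snd T U).
Proof. by move=> ?; exact: cvg_snd. Qed.

Lemma continuous_cst (z : Z) : continuous (fun _ : T => z).
Proof. by move=> ?; exact: cvg_cst. Qed.

(** The sets [phi <= c] and [phi >= c] are closed and cover [T]; agreement on [phi = c] lets both
    branches be used on a closed set. *)
Lemma continuous_ifle (R : realType) (phi : T -> R) (c : R) (F G : T -> Z) :
  continuous phi -> continuous F -> continuous G ->
  (forall x, phi x = c -> F x = G x) ->
  continuous (fun x => if phi x <= c then F x else G x).
Proof.
move=> cphi cF cG FG; apply/continuous_closedP => C clC.
rewrite (_ : _ @^-1` _ = (phi @^-1` [set r | r <= c] `&` F @^-1` C) `|`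
                         (phi @^-1` [set r | r >= c] `&` G @^-1` C)).
  apply: closedU; apply: closedI.
  - by move/continuous_closedP: cphi; apply; exact: closed_le.
  - by move/continuous_closedP: cF; apply.
  - by move/continuous_closedP: cphi; apply; exact: closed_ge.
  - by move/continuous_closedP: cG; apply.
apply/seteqP; split=> x /=.
  by case: (leP (phi x) c) => [? ?|/ltW ? ?]; [left|right].
move=> [[-> //]|[cx Gx]]; case: leP => // xc.
by rewrite FG //; apply/le_anti/andP.
Qed.

End continuity.

(** * The unit interval and its real coordinate *)

Section interval.
Variable R : realType.
Local Notation I := (unit_itv R).

Definition ival (t : I) : R := val t.

Lemma ival_continuous : continuous ival.
Proof. exact: initial_continuous. Qed.

Lemma ival_ge0 (t : I) : 0 <= ival t.
Proof. by have := set_mem (valP t); rewrite /= in_itv /= => /andP[]. Qed.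

Lemma ival_le1 (t : I) : ival t <= 1.
Proof. by have := set_mem (valP t); rewrite /= in_itv /= => /andP[]. Qed.

Lemma ival_inj : injective ival.
Proof. exact: val_inj. Qed.

Lemma ival0 : ival (itv0 R) = 0. Proof. by []. Qed.
Lemma ival1 : ival (itv1 R) = 1. Proof. by []. Qed.

Let clamp_subproof (r : R) : Num.max 0 (Num.min 1 r) \in [set` `[0, 1 : R]].
Proof.
by rewrite inE /= in_itv /= le_max lexx /= ge_max ler01 /= ge_min lexx.
Qed.

(** The retraction of the line onto the interval. Paths can thus be evaluated at any real expression
    without carrying a membership proof. *)
Definition clamp (r : R) : I := 
  @exist R (fun x => x \in [set` `[0, 1 : R]]) _ (clamp_subproof r).

Lemma ival_clamp r : ival (clamp r) = Num.max 0 (Num.min 1 r).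
Proof. by []. Qed.

Lemma clamp_le0 r : r <= 0 -> clamp r = itv0 R.
Proof.
move=> r0; apply: ival_inj; rewrite ival_clamp ival0.
by rewrite (min_idPr _) ?(le_trans r0)// (max_idPl _).
Qed.

Lemma clamp_ge1 r : 1 <= r -> clamp r = itv1 R.
Proof.
by move=> r1; apply: ival_inj; rewrite ival_clamp ival1 (min_idPl _)// (max_idPr _).
Qed.

Lemma ivalK t : clamp (ival t) = t.
Proof.
apply: ival_inj; rewrite ival_clamp (min_idPr _) ?ival_le1//.
by rewrite (max_idPr _) ?ival_ge0.
Qed.

Lemma clamp_continuous : continuous clamp.
Proof.
apply: continuous_comp_initial.
have -> : set_val \o clamp = (cst 0 : R -> R^o) \max (cst 1 \min id).
  by apply/funext.
move=> x; apply: continuous_max; first exact: cvg_cst.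
by apply: continuous_min; [exact: cvg_cst|exact: cvg_id].
Qed.

End interval.

Section real_continuity.
Variables (R : realType) (T : topologicalType).
Implicit Types f g : T -> R.

Lemma continuousD_real f g :
  continuous f -> continuous g -> continuous (fun x => f x + g x).
Proof. by move=> cf cg x; apply: (@continuousD R R^o); [exact: cf|exact: cg]. Qed.

Lemma continuousM_cst (r : R) f : continuous f -> continuous (fun x => r * f x).
Proof.
by move=> cf x; apply: (@continuousM R); [exact: cvg_cst|exact: cf].
Qed.

Lemma continuous_maxr f g :
  continuous f -> continuous g -> continuous (fun x => Num.max (f x) (g x)).
Proof. by move=> cf cg x; apply: continuous_max; [exact: cf|exact: cg]. Qed.

Lemma continuous_minr f g :
  continuous f -> continuous g -> continuous (fun x => Num.min (f x) (g x)).
Proof. by move=> cf cg x; apply: continuous_min; [exact: cf|exact: cg]. Qed.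

End real_continuity.

(** * Path spaces *)

Section paths.
Variables (R : realType).
Local Notation I := (unit_itv R).

Definition mkpath (X : topologicalType) (f : I -> X) (cf : continuous f) :
    path_space R X :=
  HB.pack_for (continuousType I X) f (isContinuous.Build _ _ f cf).

Lemma mkpathE (X : topologicalType) (f : I -> X) (cf : continuous f) t :
  path_eval (mkpath cf) t = f t.
Proof. by []. Qed.

Lemma path_ext (X : topologicalType) (w w' : path_space R X) :
  path_eval w =1 path_eval w' -> w = w'.
Proof. by move=> ww'; apply/continuousEP. Qed.

Lemma path_space_continuous (T X : topologicalType) (F : T -> path_space R X) :
  continuous (fun z : T * I => path_eval (F z.1) z.2) -> continuous F.
Proof.
move=> cF; apply: continuous_comp_initial.
by have := continuous_curry_fun cF.
Qed.

Definition peval (X : topologicalType) (w : path_space R X) (r : R) : X :=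
  path_eval w (clamp r).

Lemma peval_continuous (T X : topologicalType) (w : T -> path_space R X)
    (r : T -> R) :
  continuous w -> continuous r -> continuous (fun x => peval (w x) (r x)).
Proof.
move=> cw cr; apply: (@ctsC _ _ _ (fun x => (w x, clamp (r x)))
  (uncurry (@path_eval R X))); last exact: path_eval_continuous.
by apply: cts_pair => //; apply: ctsC => //; exact: clamp_continuous.
Qed.

Lemma peval_ival (X : topologicalType) (w : path_space R X) t :
  peval w (ival t) = path_eval w t.
Proof. by rewrite /peval ivalK. Qed.

Lemma peval_le0 (X : topologicalType) (w : path_space R X) r :
  r <= 0 -> peval w r = path_eval w (itv0 R).
Proof. by move=> r0; rewrite /peval clamp_le0. Qed.

Lemma peval_ge1 (X : topologicalType) (w : path_space R X) r :
  1 <= r -> peval w r = path_eval w (itv1 R).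
Proof. by move=> r1; rewrite /peval clamp_ge1. Qed.

Definition cst_path (X : topologicalType) (x : X) : path_space R X :=
  mkpath (@continuous_cst I X x).

End paths.

(** * Points of homotopy pullbacks and maps out of homotopy pushouts *)

Section hpullback_points.
Variables (R : realType) (B C X : topologicalType) (f : B -> X) (g : C -> X).
Local Notation I := (unit_itv R).

Let mkhpb_subproof b (w : path_space R X) c :
  path_eval w (itv0 R) = f b -> path_eval w (itv1 R) = g c ->
  (b, w, c) \in [set p : B * path_space R X * C |
    path_eval p.1.2 (itv0 R) = f p.1.1 /\ path_eval p.1.2 (itv1 R) = g p.2].
Proof. by move=> ? ?; rewrite inE. Qed.

Definition mkhpb b w c h0 h1 : hpullback R f g :=
  @exist _ (fun p => p \in [set p : B * path_space R X * C |
    path_eval p.1.2 (itv0 R) = f p.1.1 /\ path_eval p.1.2 (itv1 R) = g p.2])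
    _ (@mkhpb_subproof b w c h0 h1).

Lemma hpb_ext (p q : hpullback R f g) :
  hpb_fst p = hpb_fst q -> path_eval (hpb_path p) =1 path_eval (hpb_path q) ->
  hpb_snd p = hpb_snd q -> p = q.
Proof.
move=> e1 /path_ext e2 e3; apply: val_inj.
by rewrite [LHS]surjective_pairing [(val p).1]surjective_pairing
           [RHS]surjective_pairing [(val q).1]surjective_pairing; congr (_, _, _).
Qed.

Lemma hpb_continuous (T : topologicalType) (F : T -> hpullback R f g) :
  continuous (fun x => hpb_fst (F x)) -> continuous (fun x => hpb_path (F x)) ->
  continuous (fun x => hpb_snd (F x)) -> continuous F.
Proof.
move=> c1 c2 c3; apply: continuous_comp_initial.
have -> : set_val \o F = fun x => (hpb_fst (F x), hpb_path (F x), hpb_snd (F x)).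
  by apply/funext => x /=; case: (F x) => -[[? ?] ?] ?.
by apply: cts_pair => //; exact: cts_pair.
Qed.

End hpullback_points.

Section hpushout_elim.
Variables (R : realType) (P B C : topologicalType) (u : P -> B) (v : P -> C).
Local Notation I := (unit_itv R).
Local Notation M := (hpushout R u v).

Lemma hpushout_ind (Q : M -> Prop) :
  (forall b, Q (hpo_left R u v b)) -> (forall c, Q (hpo_right R u v c)) ->
  (forall p t, Q (hpo_mid u v (p, t))) -> forall q, Q q.
Proof.
move=> Ql Qr Qm q; rewrite -(reprK q).
by case: (repr q) => -[[]|]; [exact: Ql|exact: Qr|case; exact: Qm].
Qed.

Variable Z : topologicalType.

(* Continuity on the product with [I] is obtained by currying, since the product
   of a quotient map with the identity of a space need not be a quotient map. *)
Lemma hpo_map_param_continuous (f : B * I -> Z) (h : P * I * I -> Z)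
    (g : C * I -> Z) :
  (forall p s, h (p, itv0 R, s) = f (u p, s)) ->
  (forall p s, h (p, itv1 R, s) = g (v p, s)) ->
  continuous f -> continuous h -> continuous g ->
  continuous (fun z : M * I =>
    hpo_map (u := u) (v := v) (fun b => f (b, z.2)) (fun p => h (p, z.2))
      (fun c => g (c, z.2)) z.1).
Proof.
move=> h0 h1 cf ch cg.
have ctsl (W : topologicalType) (k : W * I -> Z) (ck : continuous k) w :
  continuous (fun s => k (w, s)).
  by apply: ctsC => //; apply: cts_pair => [|?]; [exact: continuous_cst|exact: cvg_id].
pose F b := mkpath (ctsl _ f cf b); pose G c := mkpath (ctsl _ g cg c).
pose H p := mkpath (ctsl _ h ch p).
have cl (W : topologicalType) (k : W * I -> Z) (ck : continuous k) :
    continuous (fun w => mkpath (ctsl _ k ck w)).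
  apply: path_space_continuous; rewrite (_ : (fun _ => _) = k)//.
  by apply/funext => -[].
have HF p : H (p, itv0 R) = F (u p) by apply: path_ext => s; rewrite !mkpathE.
have HG p : H (p, itv1 R) = G (v p) by apply: path_ext => s; rewrite !mkpathE.
have cK := hpo_map_continuous HF HG (cl _ _ cf) (cl _ _ ch) (cl _ _ cg).
rewrite (_ : (fun _ => _) = uncurry (@path_eval R Z) \o
    (fun z => (hpo_map F H G z.1, z.2))).
  apply: ctsC; last exact: path_eval_continuous.
  apply: cts_pair; last exact: continuous_snd.
  by apply: ctsC cK; exact: continuous_fst.
apply/funext => -[q s] /=; elim/hpushout_ind: q => [b|c|p t].
- by rewrite hpo_map_left// hpo_map_left.
- by rewrite hpo_map_right// hpo_map_right.
- by rewrite hpo_map_mid// hpo_map_mid.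
Qed.

End hpushout_elim.

(* [path_fib f] is the fibration replacing [f], with projection [hpb_snd]. *)
Notation path_fib R f := (hpullback R f idfun).

(** * Fibrewise homotopy of maps into a path fibration *)

Section vertical_homotopy.
Variables (R : realType) (T Z X : topologicalType) (f : Z -> X).
Local Notation I := (unit_itv R).
Implicit Types th : T -> path_fib R f.

(** Since [hpb_snd] is the projection to [X], the last clause keeps each track in a single fibre:
    this is homotopy over [X]. *)
Definition vhomotopic th th' : Prop :=
  exists2 K : T * I -> path_fib R f, continuous K &
    forall x, [/\ K (x, itv0 R) = th x, K (x, itv1 R) = th' x &
      forall t, hpb_snd (K (x, t)) = hpb_snd (th x)].

Lemma vhomotopic_sym th th' : vhomotopic th th' -> vhomotopic th' th.
Proof.
move=> [K cK HK]; exists (fun z => K (z.1, clamp (1 + -1 * ival z.2))).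
  apply: (@ctsC _ _ _ (fun z => (z.1, clamp (1 + -1 * ival z.2))) K) => //.
  apply: cts_pair; first exact: continuous_fst.
  apply: (@ctsC _ _ _ (fun z : T * I => 1 + -1 * ival z.2) (@clamp R)).
    apply: continuousD_real; first exact: continuous_cst.
    apply: continuousM_cst.
    by apply: (@ctsC _ _ _ snd (@ival R)); [exact: continuous_snd|exact: ival_continuous].
  exact: clamp_continuous.
move=> x; have [K0 K1 Ks] := HK x; split=> /=.
- by rewrite ival0 clamp_ge1//; lra.
- by rewrite ival1 clamp_le0//; lra.
- by move=> t; rewrite Ks -K1 Ks.
Qed.

Lemma vhomotopic_trans th1 th2 th3 :
  vhomotopic th1 th2 -> vhomotopic th2 th3 -> vhomotopic th1 th3.
Proof.
move=> [K cK HK] [L cL HL].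
have civ : continuous (fun z : T * I => ival z.2).
  by apply: (@ctsC _ _ _ snd (@ival R)); [exact: continuous_snd|exact: ival_continuous].
have cc (M : T * I -> path_fib R f) (r : T * I -> R) : continuous M ->
    continuous r -> continuous (fun z => M (z.1, clamp (r z))).
  move=> cM cr; apply: (@ctsC _ _ _ (fun z => (z.1, clamp (r z))) M) => //.
  apply: cts_pair; first exact: continuous_fst.
  by apply: ctsC => //; exact: clamp_continuous.
exists (fun z => if ival z.2 <= 1 / 2 then K (z.1, clamp (2 * ival z.2))
                 else L (z.1, clamp (2 * ival z.2 + - 1))).
  apply: continuous_ifle => //.
  - by apply: cc => //; exact: continuousM_cst.
  - apply: cc => //; apply: continuousD_real; last exact: continuous_cst.
    exact: continuousM_cst.
  - move=> [x t] /= ->.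
    rewrite clamp_ge1; last lra.
    rewrite clamp_le0; last lra.
    by have [_ -> _] := HK x; have [-> _ _] := HL x.
move=> x; have [K0 K1 Ks] := HK x; have [L0 L1 Ls] := HL x; split=> /=.
- by rewrite ival0 ifT ?clamp_le0 //; lra.
- by rewrite ival1 ifF ?clamp_ge1 //; lra.
- by move=> t; case: (ival t <= 1 / 2); [exact: Ks|rewrite Ls -K1; exact: Ks].
Qed.

End vertical_homotopy.

(** * Concatenation of a path with the end of another *)

Section path_concatenation.
Variables (R : realType) (X : topologicalType).
Implicit Types (w v : path_space R X) (m u : R).

(** The second half is truncated, not rescaled: it rests at [v m] until [2u - 1] reaches [m]. Hence
    [v t], for [m <= t], is met at [u = (1 + t) / 2] whatever [m] is, and nothing of [v] before [m]
    is used. *)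
Definition qcat w v m u : X :=
  if u <= 1 / 2 then peval w (2 * u) else peval v (Num.max m (2 * u + - 1)).

Lemma qcat_continuous (T : topologicalType) (w v : T -> path_space R X)
    (m u : T -> R) :
  continuous w -> continuous v -> continuous m -> continuous u ->
  (forall x, 0 <= m x) ->
  (forall x, path_eval (w x) (itv1 R) = peval (v x) (m x)) ->
  continuous (fun x => qcat (w x) (v x) (m x) (u x)).
Proof.
move=> cw cv cm cu m0 wv; apply: continuous_ifle => //.
- by apply: peval_continuous => //; exact: continuousM_cst.
- apply: peval_continuous => //; apply: continuous_maxr => //.
  apply: continuousD_real; last exact: continuous_cst.
  exact: continuousM_cst.
- move=> x ux; rewrite ux peval_ge1; last lra.
  by rewrite wv (max_idPl _)//; have := m0 x; lra.
Qed.

Lemma qcat_le0 w v m u : u <= 0 -> qcat w v m u = path_eval w (itv0 R).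
Proof. by move=> u0; rewrite /qcat ifT ?peval_le0//; lra. Qed.

Lemma qcat_ge1 w v m u : 1 <= u -> qcat w v m u = path_eval v (itv1 R).
Proof.
move=> u1; rewrite /qcat ifF ?peval_ge1 ?le_max//; last lra.
by apply/orP; right; lra.
Qed.

End path_concatenation.

(** * Points on the segments of a join, lifted to its path fibration *)

Section join_point.
Variables (R : realType) (Z A X : topologicalType).
Variables (f : continuousType Z X) (iota : continuousType A X).
Local Notation I := (unit_itv R).
Local Notation J := (@join_map R Z A X f iota).

Lemma join_map_left z : J (hpo_left _ _ _ z) = f z.
Proof. by apply: hpo_map_left; [exact: hpb_path0|exact: hpb_path1]. Qed.

Lemma join_map_right a : J (hpo_right _ _ _ a) = iota a.
Proof. by apply: hpo_map_right; [exact: hpb_path0|exact: hpb_path1]. Qed.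

Lemma join_map_mid p t : J (hpo_mid _ _ (p, t)) = path_eval (hpb_path p) t.
Proof. by rewrite /join_map hpo_map_mid//; [exact: hpb_path0|exact: hpb_path1]. Qed.

(** [m] is the parameter of [v] over which [e] lies, [s] the height in the join, and [t] the
    parameter of [v] over which the resulting point lies. From [s <= t <= 1] follows
    [s <= (1 + t) / 2], so the tail path runs forwards; [m <= t] makes it end at [v t]. *)
Record join_data (e : path_fib R f) (v : path_space R X) (a : A) (m s t : R)
    : Prop := JoinData {
  jd_start : hpb_snd e = peval v m;
  jd_end : path_eval v (itv1 R) = iota a;
  jd_m0 : 0 <= m; jd_mt : m <= t; jd_s0 : 0 <= s; jd_st : s <= t; jd_t1 : t <= 1
}.

Section point.
Variables (e : path_fib R f) (v : path_space R X) (a : A) (m s t : R).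
Hypothesis d : join_data e v a m s t.

Let c (u : R) := qcat (hpb_path e) v m u.

Let c_continuous (T : topologicalType) (u : T -> R) :
  continuous u -> continuous (fun x => c (u x)).
Proof.
move=> cu; apply: qcat_continuous => //; try exact: continuous_cst.
- by move=> _; exact: jd_m0 d.
- by move=> _; rewrite -(jd_start d) hpb_path1.
Qed.

Definition jp_trunc (r : R) : R := Num.max s (Num.min r ((1 + t) / 2)).

Definition jp_path : path_space R X := mkpath (c_continuous (@ival_continuous R)).

Let jp_path0 : path_eval jp_path (itv0 R) = f (hpb_fst e).
Proof. by rewrite mkpathE /c qcat_le0 ?hpb_path0. Qed.

Let jp_path1 : path_eval jp_path (itv1 R) = iota a.
Proof. by rewrite mkpathE /c qcat_ge1// (jd_end d). Qed.

Definition jp_base : hpullback R f iota := mkhpb jp_path0 jp_path1.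

Let trunc_continuous : continuous (fun r : I => jp_trunc (ival r)).
Proof.
apply: continuous_maxr; first exact: continuous_cst.
by apply: continuous_minr; [exact: ival_continuous|exact: continuous_cst].
Qed.

Definition jp_tail : path_space R X := mkpath (c_continuous trunc_continuous).

Definition jp_point : join_space R f iota := hpo_mid _ _ (jp_base, clamp s).

Let jp_tail0 : path_eval jp_tail (itv0 R) = J jp_point.
Proof.
rewrite mkpathE join_map_mid mkpathE; congr c.
have [_ _ m0 mt s0 st t1] := d.
rewrite /jp_trunc ival0 ival_clamp (min_idPl _); last lra.
by rewrite (max_idPl _)// (min_idPr _) ?(max_idPr _)//; lra.
Qed.

Let jp_tail1 : path_eval jp_tail (itv1 R) = idfun (peval v t).
Proof.
have [sv _ m0 mt s0 st t1] := d.
rewrite mkpathE /jp_trunc ival1 (min_idPr _); last lra.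
rewrite (max_idPr _); last lra.
rewrite /c /qcat; case: leP => ht.
  (* Here [(1 + t) / 2 <= 1 / 2], so [t] and hence [m] vanish; the tail then ends on the path of
     [e], whose endpoint is [v m]. *)
  have t0 : t = 0 by lra.
  have -> : 2 * ((1 + t) / 2) = 1 by lra.
  by rewrite peval_ge1// hpb_path1 /= sv; congr peval; lra.
by congr peval; rewrite (max_idPr _); lra.
Qed.

(* With [w] the path of [e] and [c] the concatenation of [w] and [v] restricted
   to [m, 1], the point at height [s] of the segment of the join joining the base
   point of [e] to [a] along [c], and then the part of [c] between the parameters
   [s] and [(1 + t) / 2], where [c] passes through [v t]. *)
Definition join_pt : path_fib R J := mkhpb jp_tail0 jp_tail1.

End point.

Lemma jp_snd e v a m s t (d : join_data e v a m s t) : hpb_snd (join_pt d) = peval v t.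
Proof. by []. Qed.

(** [qcat] sees [v] only from [m] on. In particular, for [m = 1] the path may be replaced by a
    constant one with the same endpoint. *)
Lemma jp_ext e e' v v' a a' m m' s s' t t' (d : join_data e v a m s t)
    (d' : join_data e' v' a' m' s' t') :
  e = e' -> (forall u, peval v (Num.max m u) = peval v' (Num.max m' u)) ->
  a = a' -> s = s' -> t = t' -> join_pt d = join_pt d'.
Proof.
move=> ee vv aa ss tt; subst e' a' s' t'.
have cE u : qcat (hpb_path e) v m u = qcat (hpb_path e) v' m' u.
  by rewrite /qcat vv.
apply: hpb_ext => /=.
- congr hpo_mid; congr (_, _); apply: hpb_ext => // u.
  exact: cE.
- by move=> r; exact: cE.
- rewrite !jp_snd -[t in LHS](max_idPr (jd_mt d)) vv (max_idPr _)//.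
  exact: jd_mt d'.
Qed.

Lemma jp_continuous (T : topologicalType) (e : T -> path_fib R f)
    (v : T -> path_space R X) (a : T -> A) (m s t : T -> R)
    (d : forall x, join_data (e x) (v x) (a x) (m x) (s x) (t x)) :
  continuous e -> continuous v -> continuous a ->
  continuous m -> continuous s -> continuous t ->
  continuous (fun x => join_pt (d x)).
Proof.
move=> ce cv ca cm cs ct.
have cw : continuous (fun x => hpb_path (e x)).
  by apply: (ctsC ce); exact: hpb_path_continuous.
have cc (u : T * I -> R) : continuous u -> continuous (fun z =>
    qcat (hpb_path (e z.1)) (v z.1) (m z.1) (u z)).
  move=> cu; apply: qcat_continuous => //.
  - exact: ctsC continuous_fst cw.
  - exact: ctsC continuous_fst cv.
  - exact: ctsC continuous_fst cm.
  - by move=> z; exact: jd_m0 (d _).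
  - by move=> z; rewrite -(jd_start (d _)) hpb_path1.
have ci : continuous (fun z : T * I => ival z.2).
  by apply: ctsC; [exact: continuous_snd|exact: ival_continuous].
apply: hpb_continuous.
- apply: (@ctsC _ _ _ (fun x => (jp_base (d x), clamp (s x))) (hpo_mid _ _)).
    apply: cts_pair; last by apply: ctsC => //; exact: clamp_continuous.
    apply: hpb_continuous => //.
      by apply: (ctsC ce); exact: hpb_fst_continuous.
    by apply: path_space_continuous; exact: (cc (fun z => ival z.2)).
  exact: hpo_mid_continuous.
- apply: path_space_continuous.
  apply: (cc (fun z => jp_trunc (s z.1) (t z.1) (ival z.2))).
  apply: continuous_maxr; first exact: ctsC continuous_fst cs.
  apply: continuous_minr => //.
  rewrite (_ : (fun _ => _) = (fun z : T * I => 2^-1 * (1 + t z.1))).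
    apply: continuousM_cst; apply: continuousD_real; first exact: continuous_cst.
    exact: ctsC continuous_fst ct.
  by apply/funext => z; rewrite mulrC.
- by apply: peval_continuous.
Qed.

Let right_path0 a :
  path_eval (cst_path R (iota a)) (itv0 R) = J (hpo_right _ _ _ a).
Proof. by rewrite join_map_right. Qed.

Definition right_fib a : path_fib R J :=
  @mkhpb R _ _ _ J idfun _ _ (iota a) (right_path0 a) erefl.

Let left_path_continuous (e : path_fib R f) :
  continuous (fun r : I => peval (hpb_path e) (2 * ival r)).
Proof.
apply: peval_continuous; first exact: continuous_cst.
by apply: continuousM_cst; exact: ival_continuous.
Qed.

Let left_path0 (e : path_fib R f) :
  path_eval (mkpath (@left_path_continuous e)) (itv0 R) =
  J (hpo_left _ _ _ (hpb_fst e)).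
Proof. by rewrite join_map_left mkpathE peval_le0 ?hpb_path0// ival0 mulr0. Qed.

Let left_path1 (e : path_fib R f) :
  path_eval (mkpath (@left_path_continuous e)) (itv1 R) = idfun (hpb_snd e).
Proof. by rewrite mkpathE peval_ge1 ?hpb_path1// ival1 mulr1 ler1n. Qed.

(* The path is run through at double speed, so that [left_fib] is strictly equal
   to [join_pt] for [s = 0] and [m = t]. *)
Definition left_fib e : path_fib R J := mkhpb (left_path0 e) (left_path1 e).

Lemma left_fib_continuous : continuous left_fib.
Proof.
apply: hpb_continuous.
- apply: (@ctsC _ _ _ (@hpb_fst R Z X X f idfun) (hpo_left _ _ _)).
    exact: hpb_fst_continuous.
  exact: hpo_left_continuous.
- apply: path_space_continuous; apply: peval_continuous.
    by apply: ctsC; [exact: continuous_fst|exact: hpb_path_continuous].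
  apply: continuousM_cst.
  by apply: ctsC; [exact: continuous_snd|exact: ival_continuous].
- exact: hpb_snd_continuous.
Qed.

Lemma right_fib_continuous : continuous right_fib.
Proof.
apply: hpb_continuous.
- exact: hpo_right_continuous.
- apply: path_space_continuous; apply: ctsC; first exact: continuous_fst.
  exact: cts_fun.
- exact: cts_fun.
Qed.

(** At height 0 the join point is the left end. The tail stops at [(1 + m) / 2], up to which [qcat]
    has not moved along [v] past [m], so it is the path of [e] at double speed followed by a
    rest. *)
Lemma jp_s0 e v a m s t (d : join_data e v a m s t) :
  s = 0 -> m = t -> join_pt d = left_fib e.
Proof.
move=> s0 mt; subst s t; have [sv ve m0 _ _ _ m1] := d.
apply: hpb_ext.
- change (jp_point d = hpo_left _ _ _ (hpb_fst e)).
  by rewrite /jp_point clamp_le0// hpo_mid0.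
- move=> r.
  change (qcat (hpb_path e) v m (jp_trunc 0 m (ival r)) =
          peval (hpb_path e) (2 * ival r)).
  have r0 := ival_ge0 r; have r1 := ival_le1 r.
  rewrite /jp_trunc (max_idPr _); last by rewrite le_min; apply/andP; split; lra.
  rewrite /qcat; case: (leP (ival r) ((1 + m) / 2)) => rm.
    case: leP => // r2; rewrite (max_idPl _); last lra.
    by rewrite -sv peval_ge1 ?hpb_path1//; lra.
  case: leP => m2.
    by rewrite !peval_ge1//; lra.
  rewrite (max_idPl _); last lra.
  by rewrite -sv peval_ge1 ?hpb_path1//; lra.
- exact: esym sv.
Qed.

(** At height 1 the truncated parameter is at least 1 throughout, so the tail rests at [iota a] and
    all dependence on [e] and [m] disappears. *)
Lemma jp_s1 e v a m s t (d : join_data e v a m s t) : s = 1 -> join_pt d = right_fib a.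
Proof.
move=> s1; subst s; have [sv ve m0 mt _ t1 t1'] := d.
apply: hpb_ext.
- change (jp_point d = hpo_right _ _ _ a).
  by rewrite /jp_point clamp_ge1// hpo_mid1.
- move=> r; change (qcat (hpb_path e) v m (jp_trunc 1 t (ival r)) = iota a).
  rewrite qcat_ge1 ?ve//.
  by rewrite /jp_trunc le_max lexx.
- by change (peval v t = iota a); rewrite peval_ge1.
Qed.

End join_point.

(** * Gluing fibrewise homotopies on a homotopy pushout *)

Section vertical_homotopy_pushout.
Variables (R : realType) (P B C Z X : topologicalType) (u : P -> B) (v : P -> C).
Variable f : Z -> X.
Local Notation I := (unit_itv R).
Local Notation left := (hpo_left R u v).
Local Notation right := (hpo_right R u v).
Local Notation mid := (@hpo_mid R _ _ _ u v).

Lemma vhomotopic_pushout (th th' : hpushout R u v -> path_fib R f)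
    (l : B * I -> path_fib R f) (h : P * I * I -> path_fib R f)
    (r : C * I -> path_fib R f) :
  continuous l -> continuous h -> continuous r ->
  (forall p s, h (p, itv0 R, s) = l (u p, s)) ->
  (forall p s, h (p, itv1 R, s) = r (v p, s)) ->
  (forall b, [/\ l (b, itv0 R) = th (left b), l (b, itv1 R) = th' (left b) &
     forall s, hpb_snd (l (b, s)) = hpb_snd (th (left b))]) ->
  (forall p, [/\ h (p, itv0 R) = th (mid p), h (p, itv1 R) = th' (mid p) &
     forall s, hpb_snd (h (p, s)) = hpb_snd (th (mid p))]) ->
  (forall c, [/\ r (c, itv0 R) = th (right c), r (c, itv1 R) = th' (right c) &
     forall s, hpb_snd (r (c, s)) = hpb_snd (th (right c))]) ->
  vhomotopic th th'.
Proof.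
move=> cl ch cr h0 h1 Hl Hh Hr; eexists.
  exact: (hpo_map_param_continuous h0 h1 cl ch cr).
elim/hpushout_ind => [b|c|p t].
- have [l0 l1 ls] := Hl b; split=> [||s]; rewrite hpo_map_left//=.
- have [r0 r1 rs] := Hr c; split=> [||s]; rewrite hpo_map_right//=.
- have [m0 m1 ms] := Hh (p, t); split=> [||s]; rewrite hpo_map_mid//=.
Qed.

End vertical_homotopy_pushout.

(** * Extending lifts from the left end of a join to the whole join *)

Section join_extension.
Variables (R : realType) (Y Z A X : topologicalType).
Variables (y : continuousType Y X) (f : continuousType Z X).
Variable (iota : continuousType A X).
Local Notation I := (unit_itv R).
Local Notation M := (join_space R y iota).
Local Notation P := (hpullback R y iota).
Local Notation left := (hpo_left R (@hpb_fst R Y A X y iota) (@hpb_snd R Y A X y iota)).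
Local Notation right := (hpo_right R (@hpb_fst R Y A X y iota) (@hpb_snd R Y A X y iota)).
Local Notation mid := (hpo_mid (@hpb_fst R Y A X y iota) (@hpb_snd R Y A X y iota)).

Section extension.
Variable phi : Y -> path_fib R f.
Hypothesis phiE : forall b, hpb_snd (phi b) = y b.

Let data (z : P * I) : join_data iota (phi (hpb_fst z.1)) (hpb_path z.1)
  (hpb_snd z.1) 0 (ival z.2) (ival z.2).
Proof.
by split; rewrite ?hpb_path1 ?ival_ge0 ?ival_le1// phiE peval_le0// hpb_path0.
Qed.

(** The fibrewise join of [phi] with the identity of [A]: a point at parameter [t] of a segment goes
    to height [t] in the outer join, with [m = 0] because [phi b] lies over the start of the
    path. *)
Definition join_extension : M -> path_fib R (@join_map R Z A X f iota) :=
  hpo_map (fun b => left_fib iota (phi b)) (fun z => join_pt (data z))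
    (fun a => right_fib R f iota a).

Let ext0 p : join_pt (data (p, itv0 R)) = left_fib iota (phi (hpb_fst p)).
Proof. exact: jp_s0. Qed.

Let ext1 p : join_pt (data (p, itv1 R)) = right_fib R f iota (hpb_snd p).
Proof. exact: jp_s1. Qed.

Lemma join_extension_left b : join_extension (left b) = left_fib iota (phi b).
Proof. exact: hpo_map_left. Qed.

Lemma join_extension_right a : join_extension (right a) = right_fib R f iota a.
Proof. exact: hpo_map_right. Qed.

Lemma join_extension_mid z : join_extension (mid z) = join_pt (data z).
Proof. exact: hpo_map_mid. Qed.

End extension.

(** The extension is formed at each time of the homotopy; its numerical parameters do not involve
    that time. *)
Lemma join_extension_vhomotopic (phi phi' : Y -> path_fib R f)
    (phiE : forall b, hpb_snd (phi b) = y b)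
    (phiE' : forall b, hpb_snd (phi' b) = y b) :
  vhomotopic phi phi' ->
  vhomotopic (join_extension phiE) (join_extension phiE').
Proof.
move=> [F cF HF].
have FE b s : hpb_snd (F (b, s)) = y b by have [_ _ ->] := HF b.
have d (z : P * I * I) : join_data iota (F (hpb_fst z.1.1, z.2))
    (hpb_path z.1.1) (hpb_snd z.1.1) 0 (ival z.1.2) (ival z.1.2).
  by split; rewrite ?hpb_path1 ?ival_ge0 ?ival_le1// FE peval_le0// hpb_path0.
apply: (@vhomotopic_pushout _ _ _ _ _ _ _ _ _ _ _
  (fun z => left_fib iota (F z)) (fun z => join_pt (d z))
  (fun z => right_fib R f iota z.1)).
- exact: ctsC cF (@left_fib_continuous _ _ _ _ _ _).
- have c1 : continuous (fun z : P * I * I => z.1.1).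
    exact: ctsC continuous_fst continuous_fst.
  have c2 : continuous (fun z : P * I * I => ival z.1.2).
    by apply: ctsC (@ival_continuous R); exact: ctsC continuous_fst continuous_snd.
  apply: jp_continuous => //.
  + apply: (@ctsC _ _ _ (fun z : P * I * I => (hpb_fst z.1.1, z.2)) F) => //.
    apply: cts_pair; last exact: continuous_snd.
    exact: ctsC c1 (@hpb_fst_continuous _ _ _ _ _ _).
  + exact: ctsC c1 (@hpb_path_continuous _ _ _ _ _ _).
  + exact: ctsC c1 (@hpb_snd_continuous _ _ _ _ _ _).
  + exact: continuous_cst.
- exact: ctsC continuous_fst (@right_fib_continuous _ _ _ _ _ _).
- by move=> p s; rewrite jp_s0.
- by move=> p s; rewrite jp_s1.
- move=> b; have [F0 F1 Fs] := HF b.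
  by rewrite !join_extension_left F0 F1.
- move=> z; have [F0 F1 Fs] := HF (hpb_fst z.1).
  by rewrite !join_extension_mid; split=> //; apply: jp_ext.
- by move=> a; rewrite !join_extension_right.
Qed.

Section collapse.
Variable th : M -> path_fib R f.
Hypothesis cth : continuous th.
Hypothesis thE : forall q, hpb_snd (th q) = join_map q.

Let thlE b : hpb_snd (th (left b)) = y b.
Proof. by rewrite thE join_map_left. Qed.

(* On the segment through [(p, t)], first raise the height in the outer join from
   [0] to [t], then lower the parameter in the inner join from [t] to [0]. *)
Lemma left_fib_vhomotopic_join_extension :
  vhomotopic (left_fib iota \o th) (join_extension thlE).
Proof.
(* For [t] in the unit interval, the height [h] has reached [t] by time 1/2 and [m] does not leave
   [t] before, so the two moves follow one another. *)
pose m (t : R) (s : I) := Num.min t (2 + - 2 * ival s).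
pose h (t : R) (s : I) := Num.min t (2 * ival s).
have m0 t s : 0 <= t -> 0 <= m t s.
  by move=> t0; rewrite le_min t0 /=; have := ival_le1 s; lra.
have h0 t s : 0 <= t -> 0 <= h t s.
  by move=> t0; rewrite le_min t0 /=; have := ival_ge0 s; lra.
have mt t s : m t s <= t by rewrite ge_min lexx.
have ht t s : h t s <= t by rewrite ge_min lexx.
have cm (T : topologicalType) (t : T -> R) (s : T -> I) :
    continuous t -> continuous s -> continuous (fun x => m (t x) (s x)).
  move=> ct cs; apply: continuous_minr => //; apply: continuousD_real.
    exact: continuous_cst.
  by apply: continuousM_cst; apply: ctsC cs _; exact: ival_continuous.
have chh (T : topologicalType) (t : T -> R) (s : T -> I) :
    continuous t -> continuous s -> continuous (fun x => h (t x) (s x)).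
  move=> ct cs; apply: continuous_minr => //.
  by apply: continuousM_cst; apply: ctsC cs _; exact: ival_continuous.
have d (z : P * I * I) : join_data iota
    (th (mid (z.1.1, clamp (m (ival z.1.2) z.2)))) (hpb_path z.1.1)
    (hpb_snd z.1.1) (m (ival z.1.2) z.2) (h (ival z.1.2) z.2) (ival z.1.2).
  split; rewrite ?hpb_path1 ?m0 ?h0 ?mt ?ht ?ival_le1 ?ival_ge0//.
  by rewrite thE join_map_mid.
(* Over [A] there is no segment to follow; the constant path at [iota a], with [t = 1], stands in
   for it. *)
have d' (z : A * I) : join_data iota (th (right z.1)) (cst_path R (iota z.1))
    z.1 (m 1 z.2) (h 1 z.2) 1.
  by split; rewrite ?m0 ?h0 ?mt ?ht// thE join_map_right.
apply: (@vhomotopic_pushout _ _ _ _ _ _ _ _ _ _ _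
  (fun z => left_fib iota (th (left z.1))) (fun z => join_pt (d z))
  (fun z => join_pt (d' z))).
- apply: ctsC (@left_fib_continuous _ _ _ _ _ _).
  apply: ctsC cth; apply: ctsC continuous_fst _.
  exact: hpo_left_continuous.
- have c1 : continuous (fun z : P * I * I => z.1.1).
    exact: ctsC continuous_fst continuous_fst.
  have c2 : continuous (fun z : P * I * I => ival z.1.2).
    by apply: ctsC (@ival_continuous R); exact: ctsC continuous_fst continuous_snd.
  have c3 : continuous (fun z : P * I * I => m (ival z.1.2) z.2).
    by apply: cm => //; exact: continuous_snd.
  apply: jp_continuous => //.
  + apply: ctsC cth; apply: ctsC (@hpo_mid_continuous _ _ _ _ _ _).
    by apply: cts_pair => //; apply: ctsC c3 _; exact: clamp_continuous.
  + exact: ctsC c1 (@hpb_path_continuous _ _ _ _ _ _).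
  + exact: ctsC c1 (@hpb_snd_continuous _ _ _ _ _ _).
  + by apply: chh => //; exact: continuous_snd.
- apply: jp_continuous.
  + apply: ctsC cth; apply: ctsC continuous_fst _.
    exact: hpo_right_continuous.
  + apply: path_space_continuous; apply: ctsC; last exact: cts_fun.
    exact: ctsC continuous_fst continuous_fst.
  + exact: continuous_fst.
  + by apply: cm; [exact: continuous_cst|exact: continuous_snd].
  + by apply: chh; [exact: continuous_cst|exact: continuous_snd].
  + exact: continuous_cst.
- move=> p s /=; rewrite jp_s0/=.
  + by rewrite clamp_le0 ?hpo_mid0// ival0.
  + by apply: min_l; rewrite ival0; have := ival_ge0 s; lra.
  + by apply: min_l; rewrite ival0; have := ival_le1 s; lra.
(* At [t = 1] the segment and the constant path must give the same point: from time 1/2 on the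
   height is 1 and the path is forgotten, before it [m = 1] and only the endpoint counts. *)
- move=> p s /=; have [s2|s2] := leP (1 / 2) (ival s).
    have h1 : h 1 s = 1 by apply: min_l; lra.
    by rewrite !jp_s1//= ival1.
  have m1 : m 1 s = 1 by apply: min_l; lra.
  apply: jp_ext => //=.
  + by rewrite ival1 m1 clamp_ge1// hpo_mid1.
  + by move=> u; rewrite ival1 m1 !peval_ge1 ?hpb_path1 ?le_max ?lexx.
- by move=> b; rewrite join_extension_left.
- move=> [p t]; rewrite join_extension_mid; split.
  + have mE : m (ival t) (itv0 R) = ival t.
      by apply: min_l; rewrite ival0; have := ival_le1 t; lra.
    have hE : h (ival t) (itv0 R) = 0.
      by rewrite /h ival0 mulr0 min_r ?ival_ge0.
    by rewrite jp_s0//= mE ivalK.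
  (* At the final time [th] is evaluated at the left end of the segment, which gives the data of
     [join_extension]. *)
  + have mE : m (ival t) (itv1 R) = 0.
      by rewrite /m ival1 min_r; have := ival_ge0 t; lra.
    apply: jp_ext => //=.
    * by rewrite mE clamp_le0// hpo_mid0.
    * by move=> u; rewrite mE.
    * by apply: min_l; rewrite ival1; have := ival_le1 t; lra.
  + by move=> s; rewrite jp_snd /= -[RHS]/(hpb_snd (th _)) thE join_map_mid peval_ival.
- move=> a; rewrite join_extension_right; split.
  + apply: jp_s0; first by rewrite /h ival0 mulr0 min_r ?ler01.
    by apply: min_l; rewrite /= ival0; lra.
  + by apply: jp_s1; apply: min_l; rewrite /= ival1; lra.
  + by move=> s; rewrite jp_snd -[RHS]/(hpb_snd (th _)) thE join_map_right.
Qed.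

End collapse.

(** Each composite deforms to the join extension of its restriction to [Y], and homotopic
    restrictions have homotopic extensions. *)
Lemma left_fib_vhomotopic (th th' : M -> path_fib R f) :
  continuous th -> continuous th' ->
  (forall q, hpb_snd (th q) = join_map q) ->
  (forall q, hpb_snd (th' q) = join_map q) ->
  vhomotopic (th \o left) (th' \o left) ->
  vhomotopic (left_fib iota \o th) (left_fib iota \o th').
Proof.
move=> cth cth' thE thE' thth'.
apply: vhomotopic_trans (left_fib_vhomotopic_join_extension cth thE) _.
apply: vhomotopic_trans
  (vhomotopic_sym (left_fib_vhomotopic_join_extension cth' thE')).
exact: join_extension_vhomotopic.
Qed.

(** Any lift of [iota] moves to the right end of the outer join over a constant path. With
    [m = t = 1] the height is free to run from 0, where [jp_s0] applies, to 1, where [jp_s1]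
    does. *)
Lemma left_fib_vhomotopic_right (th : A -> path_fib R f) :
  continuous th -> (forall a, hpb_snd (th a) = iota a) ->
  vhomotopic (left_fib iota \o th) (right_fib R f iota).
Proof.
move=> cth thE.
have d (z : A * I) : join_data iota (th z.1) (cst_path R (iota z.1)) z.1
    1 (ival z.2) 1.
  by split; rewrite ?ival_ge0 ?ival_le1 ?thE.
exists (fun z => join_pt (d z)).
  apply: jp_continuous; try exact: continuous_cst.
  - exact: ctsC continuous_fst cth.
  - apply: path_space_continuous; apply: ctsC; last exact: cts_fun.
    exact: ctsC continuous_fst continuous_fst.
  - exact: continuous_fst.
  - exact: ctsC continuous_snd (@ival_continuous R).
by move=> a; split; [exact: jp_s0|exact: jp_s1|move=> s; rewrite jp_snd -thE].
Qed.

End join_extension.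

(** * The canonical inclusion of a space in its path fibration *)

Section constant_paths.
Variables (R : realType) (Z X : topologicalType) (f : continuousType Z X).

Definition incl_fib (z : Z) : path_fib R f :=
  @mkhpb R _ _ _ f idfun z (cst_path R (f z)) (f z) erefl erefl.

Lemma incl_fib_continuous : continuous incl_fib.
Proof.
apply: hpb_continuous => [z||]; [exact: cvg_id| |exact: cts_fun].
apply: path_space_continuous.
by apply: ctsC; [exact: continuous_fst|exact: cts_fun].
Qed.

End constant_paths.

(** * Sections of the Ganea maps *)

Section ganea_sections.
Variables (R : realType) (A X : topologicalType) (iota : continuousType A X).
Local Notation G := (ganea_space R iota).
Local Notation g := (ganea_map R iota).
Local Notation gamma := (ganea_incl R iota).
Local Notation gamma_iter := (ganea_incl_iter R iota).

Lemma ganea_map_incl i x : g i.+1 (gamma i x) = g i x.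
Proof. exact: join_map_left. Qed.

Lemma ganea_map_incl_iter k m x : g (m + k) (gamma_iter k m x) = g k x.
Proof. by elim: m => //= m <-; exact: ganea_map_incl. Qed.

Definition ganea_left_fib i : path_fib R (g i) -> path_fib R (g i.+1) :=
  @left_fib R _ A X (g i) iota.

Lemma ganea_left_fib_continuous i : continuous (@ganea_left_fib i).
Proof. exact: left_fib_continuous. Qed.

Lemma ganea_left_fib_incl i x :
  ganea_left_fib (incl_fib R (g i) x) = incl_fib R (g i.+1) (gamma i x).
Proof.
apply: hpb_ext => [//|r|]; last exact: esym (ganea_map_incl x).
by change (g i x = g i.+1 (gamma i x)); rewrite ganea_map_incl.
Qed.

(* An equality of dependent pairs, since [n.+1 + i] and [n + i.+1] are not
   convertible. *)
Lemma ganea_incl_iter_shift i n :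
  existT (fun j => G i -> G j) (n.+1 + i)%N (gamma_iter i n.+1) =
  existT (fun j => G i -> G j) (n + i.+1)%N (gamma_iter i.+1 n \o gamma i).
Proof.
elim: n => [//|n IHn].
pose next (p : {j & G i -> G j}) : {j & G i -> G j} :=
  existT (fun j => G i -> G j) (projT1 p).+1 (gamma (projT1 p) \o projT2 p).
exact: (congr1 next IHn).
Qed.

(** A strict section of the path fibration, with agreement over [X], is what the induction can
    carry. The index and the map form a pair so that [ganea_incl_iter_shift] can rewrite both at
    once. *)
Definition vsection_extending k (p : {j & G k -> G j}) : Prop :=
  exists s : X -> path_fib R (g (projT1 p)),
    [/\ continuous s, forall x, hpb_snd (s x) = x &
      vhomotopic (s \o g k) (incl_fib R (g (projT1 p)) \o projT2 p)].

Lemma vsection_extending_step k n (s : X -> path_fib R (g (n + k))) :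
  continuous s -> (forall x, hpb_snd (s x) = x) ->
  vhomotopic (@ganea_left_fib _ \o (s \o g k))
    (@ganea_left_fib _ \o (incl_fib R (g (n + k)) \o gamma_iter k n)) ->
  vsection_extending (existT (fun j => G k -> G j) (n.+1 + k)%N (gamma_iter k n.+1)).
Proof.
move=> cs sE; exists (@ganea_left_fib _ \o s); split.
- exact: ctsC cs (@ganea_left_fib_continuous _).
- exact: sE.
- rewrite (_ : incl_fib _ _ \o _ =
    @ganea_left_fib _ \o (incl_fib R (g (n + k)) \o gamma_iter k n))//.
  by apply/funext => x; rewrite /= ganea_left_fib_incl.
Qed.

(** Induction on [k] with [n] fixed: each step spends one join with [A] to turn agreement on [G k]
    into agreement on [G k.+1]. *)
Lemma has_hsection_vsection_extending k n : has_hsection R iota n ->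
  vsection_extending (existT (fun j => G k -> G j) (n.+1 + k)%N (gamma_iter k n.+1)).
Proof.
move=> [s [H cH HE]].
have cgk i : continuous (g i) by exact: cts_fun.
have cincl k' : continuous (incl_fib R (g (n + k')) \o gamma_iter k' n).
  by apply: ctsC; [exact: cts_fun|exact: incl_fib_continuous].
have cHx x : continuous (fun t => H (x, t)).
  by apply: ctsC => //; apply: cts_pair => [|?]; [exact: continuous_cst|exact: cvg_id].
have H0 x : path_eval (mkpath (cHx x)) (itv0 R) = g n (s x) by case: (HE x).
have H1 x : path_eval (mkpath (cHx x)) (itv1 R) = idfun x by case: (HE x).
elim: k => [|k].
  (* The tracks of [H] turn the homotopy section into a strict section of the path fibration. *)
  pose s0 x : path_fib R (g n) := mkhpb (H0 x) (H1 x).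
  have cs0 : continuous s0.
    apply: hpb_continuous => [||x]; [exact: cts_fun| |exact: cvg_id].
    apply: path_space_continuous.
    by rewrite (_ : (fun _ => _) = H)//; apply/funext => -[].
  have : exists2 s' : X -> path_fib R (g (n + 0)), continuous s' &
      forall x, hpb_snd (s' x) = x by rewrite addn0; exists s0.
  move=> [s' cs' s'E]; apply: (vsection_extending_step cs') => //.
  (* Both maps lift [iota], so after one more join each is homotopic to [right_fib]. *)
  have th1 := @left_fib_vhomotopic_right R _ A X (g (n + 0)) iota
    (s' \o g 0) (ctsC (cgk 0) cs') (fun a => s'E _).
  have th2 := @left_fib_vhomotopic_right R _ A X (g (n + 0)) iota
    _ (cincl 0) (fun a => @ganea_map_incl_iter 0 n a).
  exact: vhomotopic_trans th1 (vhomotopic_sym th2).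
(* Reading [n.+1 + k] as [n + k.+1], the section obtained for [k] serves as input for [k.+1], and
   agreement on [G k] is agreement on the left end of the join [G k.+1]. *)
rewrite ganea_incl_iter_shift => -[/= s' [cs' s'E Hs']].
apply: (vsection_extending_step cs') => //.
apply: (@left_fib_vhomotopic R _ _ A X (g k) (g (n + k.+1)) iota).
- exact: (@ctsC (G k.+1) X _ (g k.+1) s' (cgk _) cs').
- exact: (cincl k.+1).
- by move=> q; exact: s'E.
- by move=> q; exact: ganea_map_incl_iter.
- rewrite (_ : (s' \o g k.+1) \o _ = s' \o g k)//.
  by apply/funext => x /=; congr s'; exact: ganea_map_incl.
Qed.

(** [hpb_fst] turns the fibrewise data into ordinary maps and homotopies, and the path component of
    [s] is the homotopy to the identity of [X]. *)
Lemma has_rel_hsection_addS k n :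
  has_hsection R iota n -> has_rel_hsection R iota k (n.+1 + k).
Proof.
move=> /(@has_hsection_vsection_extending k)[s [/= cs sE [K cK HK]]].
exists n.+1 => //.
have cfs : continuous (fun x => hpb_fst (s x)).
  exact: ctsC cs (@hpb_fst_continuous _ _ _ _ _ _).
exists (HB.pack_for (continuousType X (G (n.+1 + k))) (fun x => hpb_fst (s x))
  (isContinuous.Build _ _ _ cfs)).
split.
  exists (fun z => path_eval (hpb_path (s z.1)) z.2).
    apply: (@ctsC _ _ _ (fun z => (s z.1, z.2)) (@hpb_homotopy R _ _ _ _ _)).
      by apply: cts_pair; [exact: ctsC continuous_fst cs|exact: continuous_snd].
    exact: hpb_homotopy_continuous.
  by move=> x; rewrite /= hpb_path0 hpb_path1 /= sE.
exists (fun z => hpb_fst (K z)).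
  exact: ctsC cK (@hpb_fst_continuous _ _ _ _ _ _).
by move=> x; have [-> -> _] := HK x.
Qed.

Lemma has_rel_hsection_has_hsection k n :
  has_rel_hsection R iota k n -> has_hsection R iota n.
Proof. by move=> [m -> [s [? _]]]; exists s. Qed.

End ganea_sections.

(** * Least indices and the two inequalities *)

Section least.
Variable R : realType.
Implicit Types P Q : nat -> Prop.

Lemma least_or_infty_le P n : P n -> (least_or_infty R P <= n%:R%:E)%E.
Proof.
move=> Pn; rewrite /least_or_infty; case: pselect => [exP|[]].
  by case: ex_minnP => m _ /(_ n); rewrite lee_fin ler_nat; apply; apply/asboolP.
by exists n; apply/asboolP.
Qed.

Lemma least_or_inftyP P : least_or_infty R P = +oo%E \/
  exists2 n, P n & least_or_infty R P = n%:R%:E.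
Proof.
rewrite /least_or_infty; case: pselect => [exP|_]; last by left.
by right; case: ex_minnP => m /asboolP Pm _; exists m.
Qed.

End least.

Theorem proposition8 (R : realType) (A X : topologicalType)
    (iota : continuousType A X) (k : nat) :
  (secat R iota <= relcat R iota k)%E /\
  (relcat R iota k <= secat R iota + k%:R%:E + 1%:E)%E.
Proof.
split.
  have [|[n]] := least_or_inftyP R (has_rel_hsection R iota k).
    by rewrite /relcat => ->; rewrite leey.
  rewrite /relcat => relP ->.
  exact/least_or_infty_le/(has_rel_hsection_has_hsection relP).
have [|[n]] := least_or_inftyP R (has_hsection R iota).
  by rewrite /secat => ->; rewrite leey.
rewrite /secat => secP ->.
(* The witness [n.+1 + k] bounds the minimum and equals [n + k + 1]. *)
have := least_or_infty_le R (has_rel_hsection_addS k secP).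
by rewrite addSn -natr1 natrD !EFinD.
Qed.
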